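(* For any $n\in \mathbb{Z}^{+}$, the set $\mathcal{A}_n=\{\pi(kn):\ k\in\mathbb{Z}^+\}$ contains infinitely many $P_2$-numbers.
   Context: $\mathbb{Z}^+=\{1,2,3,\ldots\}$. For $x\ge 0$, $\pi(x)$ denotes the number of primes not exceeding $x$. A positive integer is called a $P_2$-number if it is a product of at most two (not necessarily distinct) primes. *)

(* Defs.v *)
From mathcomp Require Import all_boot.
From mathcomp Require Import classical_sets cardinality.

Set Implicit Arguments.
Unset Strict Implicit.
Unset Printing Implicit Defensive.

Local Open Scope classical_set_scope.

Definition prime_pi (x : nat) : nat := #|[set p : 'I_x.+1 | prime p]%SET|.

(* The empty product is allowed, so 1 is a P_2-number. *)
Definition P2_number (m : nat) : Prop :=
  exists s : seq nat,
    [/\ size s <= 2, all prime s & m = \prod_(p <- s) p].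

Definition pi_multiples (n : nat) : set nat :=
  [set prime_pi (k * n) | k in [set k : nat | 0 < k]].

(* Main.v *)
Require Import Defs.
From mathcomp Require Import all_boot all_order all_algebra.
From mathcomp Require Import classical_sets cardinality.
From mathcomp Require Import zify ring lra.

(** Suppose that a value [m = prime_pi p], with [p] the [m]-th prime, is not of
    the form [prime_pi (k * n)].  The first multiple of [n] from [p] on is less
    than [p + n], so the prime following [p] comes at or before that multiple,
    and [p + h] is prime for some [0 < h < n]
    ([missed_in_close_primes]).  Primes with such a close companion are rarer
    than products of two primes, and this comparison is the whole proof.

    Companions are rare.  For fixed [h], Selberg's upper bound sieve gives
    O(N / log^2 N) primes [p < N] with [p + h] prime ([close_primes_ub]).  The
    sieve is used in its orthogonal form ([selberg_sieve]): modulo each sieving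
    prime [p] there is a weight of mean 0 that takes a constant value [g p]
    off the excluded residues; products of these weights over distinct
    finite sets of primes are orthogonal up to a rounding error, by the Chinese
    remainder theorem.  The sum [F] of these products, over the sets of primes
    with product at most [z], equals a constant [G] on the unsieved integers,
    while the sum of its squares up to [N] is about [N * G]; hence at most about
    [N / G] integers survive.  The size of [G] comes from comparing it with the
    sum of the quotients (number of divisors of [m]) / [m], for [m] composed of
    the sieving primes ([smooth_sum_le_sieve_sum]); this sum is at least the
    square of a sum of reciprocals ([recip_sum_sq]), which is comparable with a
    piece of the harmonic series ([rough_sum_lb]).

    Products of two primes are frequent.  Chebyshev's lower bound, from the
    factorization of the central binomial coefficient, gives about
    x / (p log x) products [p * q <= x] for each fixed prime [p].  As the sum of
    the reciprocals of the primes diverges, there are at least K x / log x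
    products for every constant K and large x ([P2_numbers_lb]).

    With x the number of primes up to N, the products number at least a constant
    times K N / log^2 N, which for large K exceeds the number of primes with a
    close companion plus any fixed constant.  Only one large N is needed, and
    N = 2 ^ (24 * v) turns all logarithms into integers; [z = 2 ^ (2 * v)] then
    makes [z ^ 6] the square root of N. *)

Set Implicit Arguments.
Unset Strict Implicit.
Unset Printing Implicit Defensive.
Import Order.TTheory GRing.Theory Num.Theory.

(** * Chebyshev lower bound for the prime counting function *)

Lemma prime_piE x : prime_pi x = count prime (iota 0 x.+1).
Proof.
rewrite /prime_pi cardsE cardE /enum_mem size_filter.
rewrite -val_enum_ord count_map enumT; exact: eq_count.
Qed.

Lemma central_bin_lb n : 0 < n -> 4 ^ n <= n.*2 * 'C(n.*2, n).
Proof.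
elim: n => // -[_ _|n IHn _]; first by [].
rewrite expnS; apply: leq_trans (leq_mul (leqnn 4) (IHn isT)) _.
have e1 : n.+2 * 'C(n.+2.*2, n.+2) = n.+2.*2 * 'C(n.+2.*2.-1, n.+1).
  by rewrite -mul_bin_diag.
have e2 : n.+2.*2.-1 * 'C(n.+2.*2.-2, n.+1) = (n.+2.*2.-1 - n.+1) * 'C(n.+2.*2.-1, n.+1).
  by rewrite -mul_bin_down.
have e3 : n.+2.*2.-2 = n.+1.*2 by lia.
rewrite e3 in e2; nia.
Qed.

(** By Legendre's formula the exponent of [p] in C(2n, n) is the sum over [k] of
    [2n / p^k - 2 (n / p^k)] (integer quotients); each term is at most 1, and it
    vanishes once [p ^ k > 2n]. *)
Lemma pfactor_central_bin n p : prime p -> 0 < n ->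
  p ^ logn p 'C(n.*2, n) <= n.*2.
Proof.
move=> p_pr n0.
have p1 := prime_gt1 p_pr.
apply: leq_trans (trunc_logP p1 _); last by lia.
rewrite leq_exp2l //.
set t := trunc_log p n.*2.
have hC : 0 < 'C(n.*2, n) by rewrite bin_gt0; lia.
have := bin_fact (_ : n <= n.*2); rewrite (_ : n.*2 - n = n); last by lia.
move=> /(_ ltac:(lia)) /(congr1 (logn p)).
rewrite !lognM ?muln_gt0 ?fact_gt0 // => e.
have ub : logn p (n.*2)`! <= logn p n`! + logn p n`! + t.
  rewrite !logn_fact //.
  have -> : \sum_(1 <= k < n.+1) n %/ p ^ k = \sum_(1 <= k < n.*2.+1) n %/ p ^ k.
    rewrite [RHS](@big_cat_nat _ _ _ n.+1) //=; last by lia.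
    rewrite [X in _ = _ + X]big_nat_cond [X in _ = _ + X]big1 ?addn0 //.
    move=> i /andP[/andP[hi _] _].
    by rewrite divn_small //; apply: ltn_trans (ltn_expl i p1); lia.
  have -> : t = \sum_(1 <= k < n.*2.+1) (k <= t).
    rewrite (@big_cat_nat _ _ _ t.+1) //=; last first.
      rewrite ltnS; apply: leq_trans (ltnW (ltn_expl t p1)) _.
      by apply: trunc_logP => //; lia.
    rewrite [X in _ = _ + X]big_nat_cond [X in _ = _ + X]big1 ?addn0; last by move=> i; lia.
    rewrite big_nat (eq_bigr (fun=> 1)); last by move=> i; lia.
    by rewrite -big_nat sum_nat_const_nat; lia.
  rewrite -!big_split /= big_nat [leqRHS]big_nat; apply: leq_sum => k hk.
  set q := p ^ k; have q0 : 0 < q by rewrite expn_gt0 ltnW.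
  case: (leqP k t) => hkt.
    have := leq_divM n.*2 q; have := ltn_ceil n q0; nia.
  rewrite divn_small //; apply: leq_trans (trunc_log_ltn n.*2 p1) _.
  by rewrite leq_exp2l.
lia.
Qed.

(** Each of the at most [prime_pi (2n)] prime powers composing C(2n, n) is at
    most [2n], so [4 ^ n / (2n) <= (2n) ^ prime_pi (2n)]; here [2n = 2 ^ k] and
    the exponents of 2 are compared. *)
Lemma chebyshev_pow2 k : 0 < k -> 2 ^ k <= k * (prime_pi (2 ^ k)).+1.
Proof.
case: k => // k _; pose n := 2 ^ k.
have e2 : 2 ^ k.+1 = n.*2 by rewrite expnS /n; lia.
have n0 : 0 < n by rewrite expn_gt0.
have hC : 0 < 'C(n.*2, n) by rewrite bin_gt0; lia.
have ubC : 'C(n.*2, n) <= n.*2 ^ prime_pi n.*2.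
  rewrite {1}(prod_prime_decomp hC) prime_decompE big_map /=.
  apply: (@leq_trans (\prod_(p <- primes 'C(n.*2, n)) n.*2)).
    rewrite big_seq [leqRHS]big_seq; apply: leq_prod => p.
    by rewrite mem_primes => /andP[pp _]; apply: pfactor_central_bin.
  rewrite big_const_seq count_predT iter_muln_1 leq_exp2l; last by lia.
  rewrite prime_piE -size_filter uniq_leq_size ?primes_uniq // => p pC.
  move: (pC); rewrite mem_primes mem_filter mem_iota add0n ltnS => /andP[pp _].
  rewrite pp /=; apply: leq_trans (pfactor_central_bin pp n0).
  by rewrite -{1}[p]expn1 leq_exp2l ?prime_gt1 // logn_gt0.
have := leq_trans (central_bin_lb n0) (leq_mul (leqnn n.*2) ubC).
rewrite -expnS -e2 -expnM -[4]/(2 ^ 2) -expnM mul2n leq_exp2l // e2 -mul2n.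
exact.
Qed.

(** A form uniform in [y] up to [2 ^ L], as needed when [y = x / p] for several
    [p] at once; the factor 2 is the cost of rounding [y] to a power of 2. *)
Lemma chebyshev L y : 0 < L -> y <= 2 ^ L -> y <= L.*2 * (prime_pi y).+1.
Proof.
move=> L0 yL; have [y1|y1] := leqP y 1; first by nia.
have /andP[h1 h2] := @trunc_log_bounds 2 y isT (ltnW y1).
set k := trunc_log 2 y in h1 h2.
have k0 : 0 < k by rewrite /k trunc_log_gt0.
have kL : k <= L by rewrite -(leq_exp2l _ _ (isT : 1 < 2)) (leq_trans h1).
have hpi : prime_pi (2 ^ k) <= prime_pi y.
  by rewrite !prime_piE -(subnKC h1) -addSn iotaD count_cat leq_addr.
have := chebyshev_pow2 k0; rewrite expnS in h2; nia.
Qed.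

Local Open Scope ring_scope.

(** * Sums over integers with prescribed prime factors *)

Lemma ler_sum_sub_seq (I : eqType) (r1 r2 : seq I) (F : I -> rat) :
  uniq r1 -> {subset r1 <= r2} -> (forall i, i \in r2 -> 0 <= F i) ->
  \sum_(i <- r1) F i <= \sum_(i <- r2) F i.
Proof.
elim: r1 r2 => [|x r1 IH] r2 /=.
  by move=> _ _ F0; rewrite big_nil big_seq sumr_ge0.
move=> /andP[xr1 u1] sub F0.
have xr2 : x \in r2 by apply: sub; rewrite mem_head.
rewrite big_cons (big_rem x xr2) lerD2l; apply: IH => // y yr1.
  have yx : y != x by apply: contraNneq xr1 => <-.
  have := perm_mem (perm_to_rem xr2) y.
  by rewrite sub ?inE ?yr1 ?orbT // (negPf yx).
by apply: F0; apply: mem_rem yr1.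
Qed.

Definition smooth (s : seq nat) (m : nat) := all [in s] (primes m).

Definition smooth_sum (c : nat -> rat) (s : seq nat) (z : nat) : rat :=
  \sum_(1 <= m < z.+1 | smooth s m) c m.

Lemma sum_multiples (P : pred nat) (F : nat -> rat) p z : (0 < p)%N ->
  \sum_(1 <= m < z.+1 | P m && (p %| m)%N) F m =
  \sum_(1 <= m < (z %/ p).+1 | P (p * m)%N) F (p * m)%N.
Proof.
move=> p0.
transitivity (\sum_(m <- [seq (p * k)%N | k <- index_iota 1 (z %/ p).+1] | P m) F m);
  last by rewrite big_map.
rewrite -big_filter -[RHS]big_filter; apply: perm_big; apply: uniq_perm.
- by rewrite filter_uniq // iota_uniq.
- rewrite filter_uniq // map_inj_uniq; first exact: iota_uniq.
  by move=> a b /= e; apply/eqP; rewrite -(eqn_pmul2l p0) e eqxx.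
move=> m; rewrite !mem_filter mem_index_iota -andbA; congr andb; apply/idP/idP.
  case/andP => /dvdnP[k ->] hk; rewrite mulnC; apply/mapP; exists k => //.
  rewrite mem_index_iota !ltnS leq_divRL //.
  by move: hk; rewrite !ltnS muln_gt0 => /andP[/andP[-> _] ->].
case/mapP=> k; rewrite mem_index_iota !ltnS leq_divRL // => /andP[k0 kz] ->.
by rewrite dvdn_mulr // muln_gt0 p0 k0 mulnC.
Qed.

Lemma smooth_mull s p m : (0 < p)%N -> (0 < m)%N -> smooth s (p * m) -> smooth s m.
Proof.
move=> p0 m0 /allP h; apply/allP => q qm; apply: h.
by rewrite primesM // qm orbT.
Qed.

Lemma smooth_mul s a b : (0 < a)%N -> (0 < b)%N ->
  smooth s a -> smooth s b -> smooth s (a * b).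
Proof.
move=> a0 b0 /allP ha /allP hb; apply/allP => q.
by rewrite primesM // => /orP[/ha|/hb].
Qed.

Lemma smooth_cons s p m : smooth (p :: s) m -> ~~ (p %| m)%N -> smooth s m.
Proof.
move=> /allP h pm; apply/allP => q qm; have := h _ qm; rewrite inE => /orP[/eqP e|//].
by move: qm; rewrite e mem_primes (negPf pm) !andbF.
Qed.

(** Buchstab-like recursion: the integers not divisible by [p] only involve [s],
    and the multiples of [p] are reindexed by [m = p * m']. *)
Lemma smooth_sum_cons c s p z (k : rat) : (0 < p)%N -> (forall m, 0 <= c m) ->
  (forall m, (0 < m)%N -> c (p * m)%N <= k / p%:R * c m) ->
  smooth_sum c (p :: s) z <= smooth_sum c s z + k / p%:R * smooth_sum c (p :: s) (z %/ p).
Proof.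
move=> p0 c0 ck; rewrite /smooth_sum (bigID (fun m => p %| m)%N) /= addrC; apply: lerD.
  rewrite big_mkcond [leRHS]big_mkcond; apply: ler_sum => m _.
  case: ifP => [/andP[/smooth_cons h /h ->]//|_]; by case: ifP.
rewrite sum_multiples // mulr_sumr big_mkcond [leRHS]big_mkcond !big_nat.
apply: ler_sum => m /andP[m0 _].
case: ifP => [/smooth_mull -> //|_]; first exact: ck.
case: ifP => // _; apply: le_trans (ck _ m0); exact: c0.
Qed.

Lemma smooth_sum_mono c s z1 z2 : (forall m, 0 <= c m) -> (z1 <= z2)%N ->
  smooth_sum c s z1 <= smooth_sum c s z2.
Proof.
move=> c0 h; rewrite /smooth_sum [leRHS](@big_cat_nat _ _ _ z1.+1) //= lerDl.
exact: sumr_ge0.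
Qed.

Lemma smooth_sum_ge0 c s z : (forall m, 0 <= c m) -> 0 <= smooth_sum c s z.
Proof. by move=> c0; apply: sumr_ge0. Qed.

Lemma smooth_sum_nil c z :
  smooth_sum c [::] z = if (0 < z)%N then c 1%N else 0.
Proof.
rewrite /smooth_sum; case: z => [|z]; first by rewrite big_nil.
rewrite big_ltn_cond //= big_nat_cond big1 ?addr0 // => m /andP[/andP[m1 _]] /allP h.
have := h (pdiv m); rewrite mem_primes pdiv_prime // pdiv_dvd ltnW //= => /(_ isT).
by [].
Qed.

(** The sum, over the square-free [d <= z] composed of primes in [s], of the
    product of [g p] over the primes [p] dividing [d]; see [sieve_sumE].  The
    recursive form is the one that matches [smooth_sum_cons]. *)
Fixpoint sieve_sum (g : nat -> rat) (s : seq nat) (z : nat) : rat :=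
  if s is p :: s' then sieve_sum g s' z + g p * sieve_sum g s' (z %/ p) else (0 < z)%:R.

Lemma sieve_sum_ge0 g s z : (forall p, p \in s -> 0 <= g p) -> 0 <= sieve_sum g s z.
Proof.
elim: s z => [|p s IH] z g0 /=; first exact: ler0n.
have g0' q : q \in s -> 0 <= g q by move=> qs; apply: g0; rewrite inE qs orbT.
by rewrite addr_ge0 ?mulr_ge0 ?IH ?g0 ?mem_head.
Qed.

Lemma sieve_sum_mono g s z1 z2 : (forall p, p \in s -> 0 <= g p) -> (z1 <= z2)%N ->
  sieve_sum g s z1 <= sieve_sum g s z2.
Proof.
elim: s z1 z2 => [|p s IH] z1 z2 g0 h /=; first by rewrite ler_nat; lia.
have g0' q : q \in s -> 0 <= g q by move=> qs; apply: g0; rewrite inE qs orbT.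
by rewrite lerD ?ler_wpM2l ?IH ?g0 ?mem_head ?leq_div2r.
Qed.

(** A lower bound for the Selberg denominator.  When [g p] is the sum of the
    powers [(k / p) ^ i] with [i >= 1], the right side sums all integers whose
    radical is at most [z].  The proof compares the two recursions, by induction
    on [s] and then on [z]: one extra factor [p] costs [k / p] on the left, and
    [k / p * (1 + g p) <= g p] absorbs all the powers of [p] at once. *)
Lemma smooth_sum_le_sieve_sum c g s (k : rat) z :
  (forall m, 0 <= c m) -> c 1%N <= 1 -> 0 <= k ->
  (forall p, p \in s -> [/\ (1 < p)%N, 0 <= g p, k / p%:R * (1 + g p) <= g p &
     forall m, (0 < m)%N -> c (p * m)%N <= k / p%:R * c m]) ->
  smooth_sum c s z <= sieve_sum g s z.
Proof.
move=> c0 c1 k0; elim: s z => [|p s IH] z hs.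
  by rewrite smooth_sum_nil //=; case: ifP.
have sub q : q \in s -> q \in p :: s by rewrite inE orbC => ->.
have hs' q (qs : q \in s) := hs q (sub q qs).
have g0 q : q \in s -> 0 <= g q by case/hs'.
have [p1 gp0 kp cp] := hs p (mem_head _ _).
elim/ltn_ind: z => z IHz.
apply: le_trans (smooth_sum_cons s z (ltnW p1) c0 cp) _ => /=.
apply: lerD; first exact: IH.
case: (posnP z) => [->|z0].
  rewrite div0n {1}/smooth_sum big_nil mulr0 mulr_ge0 //; exact: sieve_sum_ge0.
have kp0 : 0 <= k / p%:R by rewrite divr_ge0.
apply: le_trans (ler_wpM2l kp0 (IHz _ (ltn_Pdiv p1 z0))) _ => /=.
have m1 : sieve_sum g s (z %/ p %/ p) <= sieve_sum g s (z %/ p).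
  by apply: sieve_sum_mono => //; apply: leq_div.
apply: le_trans (_ : k / p%:R * (1 + g p) * sieve_sum g s (z %/ p) <= _).
  by rewrite -mulrA ler_wpM2l // mulrDl mul1r lerD2l ler_wpM2l.
by apply: ler_wpM2r => //; apply: sieve_sum_ge0.
Qed.

(** * Divisor sums and the divergence of the sum of prime reciprocals *)

Definition recip (m : nat) : rat := m%:R^-1.
Definition tau_recip (m : nat) : rat := (size (divisors m))%:R / m%:R.

Lemma recip_ge0 m : 0 <= recip m.
Proof. by rewrite /recip invr_ge0. Qed.

Lemma tau_recip_ge0 m : 0 <= tau_recip m.
Proof. by rewrite /tau_recip divr_ge0. Qed.

Lemma recipM a b : recip (a * b) = recip a * recip b.
Proof. by rewrite /recip natrM invfM. Qed.

Lemma size_divisors_mul p m : prime p -> (0 < m)%N ->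
  (size (divisors (p * m)) <= 2 * size (divisors m))%N.
Proof.
move=> pp m0; have p0 := prime_gt0 pp.
have pm0 : (0 < p * m)%N by rewrite muln_gt0 p0.
rewrite mul2n -addnn -[X in (_ <= _ + X)%N](size_map (muln p)) -size_cat.
have [u _ _] := divisors_correct pm0.
apply: uniq_leq_size => // d; rewrite -dvdn_divisors // mem_cat => dpm.
have [pd|pd] := boolP (p %| d)%N; last first.
  rewrite -dvdn_divisors // -(@Gauss_dvdr _ p) ?dpm //.
  by rewrite coprime_sym prime_coprime.
apply/orP; right; case/dvdnP: pd dpm => k ->; rewrite mulnC dvdn_pmul2l // => km.
by apply: map_f; rewrite -dvdn_divisors.
Qed.

Lemma tau_recip_mul p m : prime p -> (0 < m)%N ->
  tau_recip (p * m) <= 2 / p%:R * tau_recip m.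
Proof.
move=> pp m0; rewrite /tau_recip natrM invfM.
rewrite [leRHS](_ : _ = (2 * size (divisors m))%:R * (p%:R^-1 / m%:R));
  last by rewrite natrM; ring.
by rewrite ler_wpM2r ?mulr_ge0 ?invr_ge0 // ler_nat size_divisors_mul.
Qed.

(** A product of two integers up to [y] is at most [y * y], and [m] is such a
    product in at most [size (divisors m)] ways. *)
Lemma recip_sum_sq s y :
  smooth_sum recip s y ^+ 2 <= smooth_sum tau_recip s (y * y).
Proof.
have h1 : \sum_(1 <= a < y.+1 | smooth s a)
     \sum_(1 <= m < (y * y).+1 | smooth s m && (a %| m)%N) recip m
   <= smooth_sum tau_recip s (y * y).
  rewrite (exchange_big_dep (smooth s)) /=; last by move=> a m _ /andP[].
  rewrite /smooth_sum big_nat_cond [leRHS]big_nat_cond.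
  apply: ler_sum => m /andP[/andP[m0 _] sm].
  rewrite -big_filter big_const_seq count_predT iter_addr_0 -mulr_natl.
  rewrite ler_wpM2r ?recip_ge0 // ler_nat.
  apply: uniq_leq_size; first by rewrite filter_uniq // iota_uniq.
  by move=> a; rewrite mem_filter -dvdn_divisors // => /andP[/andP[_ /andP[]]].
apply: le_trans h1; rewrite expr2 {1}/smooth_sum mulr_suml.
rewrite big_nat_cond [leRHS]big_nat_cond; apply: ler_sum => a /andP[/andP[a0 ay] sa].
rewrite sum_multiples // mulr_sumr.
have yle : (y <= y * y %/ a)%N by rewrite leq_divRL // leq_mul2l -ltnS ay orbT.
rewrite [leRHS](@big_cat_nat _ _ _ y.+1) //=.
apply: le_trans (_ : _ <= \sum_(1 <= i < y.+1 | smooth s (a * i)) recip (a * i)) _;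
  last first.
  by rewrite lerDl sumr_ge0 // => i _; apply: recip_ge0.
rewrite big_nat_cond big_mkcond [leRHS]big_nat_cond [leRHS]big_mkcond.
apply: ler_sum => b _.
case: ifP => [/andP[b0 sb]|_]; last by case: ifP => // _; apply: recip_ge0.
have b1 : (0 < b)%N by case/andP: b0.
by rewrite b0 smooth_mul // recipM.
Qed.

Definition primes_in (T z : nat) := [seq p <- iota 0 z.+1 | prime p && (T < p)%N].

Lemma mem_primes_in T z p : (p \in primes_in T z) = [&& prime p, (T < p)%N & (p <= z)%N].
Proof. by rewrite mem_filter mem_iota ltnS -andbA. Qed.

Lemma uniq_primes_in T z : uniq (primes_in T z).
Proof. by rewrite filter_uniq ?iota_uniq. Qed.

(** Each dyadic block of the harmonic series contributes at least 1/2. *)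
Lemma harmonic_lb w : w%:R / 2 <= \sum_(1 <= j < (2 ^ w).+1) recip j.
Proof.
elim: w => [|w IH]; first by rewrite mul0r sumr_ge0 // => j _; apply: recip_ge0.
rewrite (@big_cat_nat _ _ _ (2 ^ w).+1) //=; last by rewrite ltnS leq_exp2l.
rewrite -natr1 mulrDl; apply: lerD => //.
have c : \sum_((2 ^ w).+1 <= j < (2 ^ w.+1).+1) recip (2 ^ w.+1) = 1 / 2.
  have -> : \sum_((2 ^ w).+1 <= j < (2 ^ w.+1).+1) recip (2 ^ w.+1) =
      recip (2 ^ w.+1) *+ (2 ^ w).
    by rewrite sumr_const_nat; congr (_ *+ _); rewrite expnS; lia.
  rewrite /recip expnS natrM -mulr_natr; field.
  by rewrite pnatr_eq0 -lt0n expn_gt0.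
rewrite -c; apply: ler_sum_nat => j /andP[j0 jw].
by rewrite /recip lef_pV2 ?posrE ?ltr0n ?expn_gt0 ?ler_nat //; lia.
Qed.

(** The integers [T`! * j + 1] have no prime factor up to [T], and their
    reciprocals are comparable with the harmonic series. *)
Lemma rough_sum_lb T z w : (T`! * 2 ^ w < z)%N ->
  w%:R / (2 * (T`! + 1)%:R) <= smooth_sum recip (primes_in T z) z.
Proof.
move=> hz; set D := T`!.
have D0 : (0 < D)%N by apply: fact_gt0.
apply: le_trans
  (_ : \sum_(j <- [seq (D * j).+1 | j <- index_iota 1 (2 ^ w).+1]) recip j <= _).
  rewrite big_map invfM mulrA; have := harmonic_lb w.
  set S := \sum_(_ <= _ < _) _ => hS.
  apply: le_trans (ler_wpM2r (_ : 0 <= (D + 1)%:R^-1) hS) _; first by rewrite invr_ge0.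
  rewrite mulr_suml; apply: ler_sum_nat => j /andP[j0 _].
  rewrite -[_^-1]/(recip _) -recipM /recip lef_pV2 ?posrE ?ltr0n ?ler_nat //; nia.
rewrite /smooth_sum -[leRHS]big_filter; apply: ler_sum_sub_seq.
- rewrite map_inj_uniq; first exact: iota_uniq.
  by move=> a b /= [e]; apply/eqP; rewrite -(eqn_pmul2l D0) e.
- move=> a /mapP[j]; rewrite mem_index_iota => /andP[j0 jw] ->.
  rewrite mem_filter mem_index_iota /= ltnS.
  have az : ((D * j).+1 <= z)%N by apply: leq_ltn_trans hz; rewrite leq_mul2l -ltnS jw orbT.
  rewrite az andbT; apply/allP => p; rewrite mem_primes mem_primes_in => /and3P[pp _ pd].
  rewrite pp (leq_trans (dvdn_leq _ pd) az) // andbT ltnNge; apply/negP => pT.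
  have pD : (p %| D * j)%N by rewrite dvdn_mulr // dvdn_fact // prime_gt0.
  by move: pd; rewrite -addn1 dvdn_addr // dvdn1 => /eqP p1; rewrite p1 in pp.
by move=> i _; apply: recip_ge0.
Qed.

(** The Euler product over [s] bounds the sum by the inverse of the product of
    the [1 - 1/p], and that product is at least [1 - \sum 1/p]. *)
Lemma smooth_sum_euler s z : all prime s ->
  \sum_(p <- s) recip p <= 1 ->
  smooth_sum recip s z * (1 - \sum_(p <- s) recip p) <= 1.
Proof.
elim: s => [_ _|p s IH /= /andP[pp ps]]; 
  first by rewrite big_nil subr0 mulr1 smooth_sum_nil; case: ifP.
rewrite big_cons; set S := \sum_(_ <- _) _ => h.
have S0 : 0 <= S by apply: sumr_ge0 => i _; apply: recip_ge0.
have x0 := recip_ge0 p.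
have p0 := prime_gt0 pp.
have := smooth_sum_cons s z p0 recip_ge0 (k := 1) _.
have -> : 1 / p%:R = recip p by rewrite mul1r.
move/(_ (fun m _ => ltac:(by rewrite recipM))) => e.
have mono := smooth_sum_mono (p :: s) recip_ge0 (leq_div z p).
have e2 : smooth_sum recip (p :: s) z * (1 - recip p) <= smooth_sum recip s z by nra.
have IHs := IH ps ltac:(rewrite -/S; lra); rewrite -/S in IHs.
have W0 := smooth_sum_ge0 (p :: s) z recip_ge0.
have : smooth_sum recip (p :: s) z * (1 - recip p) * (1 - S) <=
    smooth_sum recip s z * (1 - S).
  by apply: ler_wpM2r => //; lra.
have : 0 <= smooth_sum recip (p :: s) z * (recip p * S) by rewrite !mulr_ge0.
lra.
Qed.

(** If the primes above [T] had a reciprocal sum below 1/2, the Euler product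
    would keep the sum over integers free of primes up to [T] below 2, whereas
    [rough_sum_lb] makes it at least 4. *)
Lemma prime_recip_tail T :
  exists z, (T <= z)%N /\ 1 / 2 <= \sum_(p <- primes_in T z) recip p.
Proof.
(* chosen so that the bound of rough_sum_lb is 4 *)
pose w := (8 * (T`! + 1))%N.
exists (T + T`! * 2 ^ w).+1; split; first by lia.
set z := (T + _).+1.
rewrite leNgt; apply/negP => h.
have hz : (T`! * 2 ^ w < z)%N by rewrite /z; lia.
have lb := rough_sum_lb hz.
have ps : all prime (primes_in T z) by apply/allP => p; rewrite mem_primes_in => /andP[].
have := smooth_sum_euler z ps ltac:(lra).
have : w%:R / (2 * (T`! + 1)%:R) = 4 :> rat.
  rewrite /w natrM natrD; field; apply: lt0r_neq0; have := ler0n rat T`!; lra.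
nra.
Qed.

Lemma prime_recip_diverges K : exists z, K%:R / 2 <= \sum_(p <- primes_in 0 z) recip p.
Proof.
elim: K => [|K [z hz]].
  by exists 0%N; rewrite mul0r sumr_ge0 // => i _; apply: recip_ge0.
have [z' [zz' hz']] := prime_recip_tail z.
exists z'.
have -> : \sum_(p <- primes_in 0 z') recip p =
    \sum_(p <- primes_in 0 z) recip p + \sum_(p <- primes_in z z') recip p.
  rewrite -big_cat; apply: perm_big.
  apply: uniq_perm; rewrite ?cat_uniq ?uniq_primes_in //= ?andbT.
    apply/hasPn => p; rewrite !mem_primes_in => /and3P[_ zp _].
    by apply/negP => /and3P[_ _]; lia.
  by move=> p; rewrite mem_cat !mem_primes_in; case: (prime p) => //=; lia.
rewrite -natr1; lra.
Qed.

(** * Square-free sieve supports and sums of periodic functions *)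

(** The sets of primes of [s] with product at most [z], as subsequences of [s];
    lists, not square-free integers, so that the recursion is that of
    [sieve_sum]. *)
Fixpoint sieve_supports (s : seq nat) (z : nat) : seq (seq nat) :=
  if s is p :: s' then
    sieve_supports s' z ++ [seq p :: A | A <- sieve_supports s' (z %/ p)]
  else if (0 < z)%N then [:: [::]] else [::].

Lemma sieve_sumE g s z :
  sieve_sum g s z = \sum_(A <- sieve_supports s z) \prod_(p <- A) g p.
Proof.
elim: s z => [|p s IH] z /=; first by case: ifP; rewrite ?big_seq1 ?big_nil.
rewrite big_cat big_map /= -IH; congr (_ + _); rewrite IH mulr_sumr.
by apply: eq_bigr => A _; rewrite big_cons.
Qed.

Lemma sieve_supports_sub s z A : A \in sieve_supports s z -> subseq A s.
Proof.
elim: s z A => [|p s IH] z A /=; first by case: ifP; rewrite ?inE // => _ /eqP ->.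
rewrite mem_cat => /orP[/IH h|/mapP[A' /IH h ->]] /=; last by rewrite eqxx.
exact: subseq_trans h (subseq_cons _ _).
Qed.

Lemma sieve_supports_prod s z A : all prime s -> A \in sieve_supports s z ->
  (\prod_(p <- A) p <= z)%N.
Proof.
elim: s z A => [|p s IH] z A /=.
  by case: ifP; rewrite ?inE // => z0 _ /eqP ->; rewrite big_nil.
move=> /andP[pp ps]; rewrite mem_cat => /orP[/IH ->//|/mapP[A' /IH h ->]].
by rewrite big_cons mulnC -leq_divRL ?prime_gt0 // h.
Qed.

Lemma uniq_sieve_supports s z : uniq s -> uniq (sieve_supports s z).
Proof.
elim: s z => [|p s IH] z /=; first by case: ifP.
move=> /andP[ps us]; rewrite cat_uniq IH //= map_inj_uniq; last by move=> a b [].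
rewrite IH // andbT; apply/hasPn => B /mapP[A _ ->].
apply/negP => /sieve_supports_sub /mem_subseq h.
by move: ps; rewrite h ?mem_head.
Qed.

(** By unique factorization, distinct supports have distinct products, which lie
    between 1 and [z]. *)
Lemma size_sieve_supports s z : uniq s -> all prime s -> (size (sieve_supports s z) <= z)%N.
Proof.
move=> us ps; pose P (A : seq nat) := \prod_(p <- A) p.
have pA A : A \in sieve_supports s z -> all prime A.
  by move=> /sieve_supports_sub /mem_subseq h; apply/allP => q /h; apply: (allP ps).
have inj : {in sieve_supports s z &, injective P}.
  have det A : A \in sieve_supports s z -> A = [seq p <- s | p %| P A]%N.
    move=> hA; rewrite {1}(subseq_uniqP us (sieve_supports_sub hA)).
    apply: eq_in_filter => p ps'.
    have pp := allP ps _ ps'.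
    rewrite /P Euclid_dvd_prod // big_has.
    apply/idP/hasP => [pA'|[q qA]]; first by exists p.
    by rewrite dvdn_prime2 ?(allP (pA _ hA) q qA) // => /eqP ->.
  by move=> A B hA hB e; rewrite (det _ hA) (det _ hB) e.
rewrite -(size_map P) -[leqRHS](size_iota 1); apply: uniq_leq_size.
  by rewrite map_inj_in_uniq // uniq_sieve_supports.
move=> m /mapP[A hA ->]; rewrite mem_iota add1n ltnS (sieve_supports_prod ps hA) andbT.
by rewrite /P big_seq prodn_cond_gt0 // => q /(allP (pA _ hA)) /prime_gt0.
Qed.

(** As [m] is invertible modulo [p], [i * m + b] runs over all residues. *)
Lemma sum_shift_mod p m b (f : nat -> rat) : coprime p m -> (0 < p)%N ->
  (forall a, f (a %% p)%N = f a) ->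
  \sum_(0 <= i < p) f (i * m + b)%N = \sum_(0 <= i < p) f i.
Proof.
case: p => // p cpm _ per; rewrite !big_mkord.
pose h (i : 'I_p.+1) : 'I_p.+1 := inord ((i * m + b) %% p.+1)%N.
have hE i : h i = ((i * m + b) %% p.+1)%N :> nat by rewrite inordK ?ltn_pmod.
have inj : injective h.
  move=> i j /(congr1 val) /=; rewrite !hE => /eqP; rewrite eqn_modDr.
  move=> e; apply/val_inj => /=.
  wlog ij : i j e / (j <= i)%N.
    by move=> H; case: (leqP j i) => [/H->//|/ltnW /H <-//]; rewrite eq_sym.
  move: e; rewrite eqn_mod_dvd ?leq_mul2r ?ij ?orbT // -mulnBl Gauss_dvdl //.
  case: (posnP (i - j)) => [|d0]; first by lia.
  by move=> /(dvdn_leq d0); have := ltn_ord i; lia.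
rewrite [RHS](reindex_inj inj) /=; apply: eq_bigr => i _.
by rewrite hE per.
Qed.

(** The Chinese remainder theorem, in the form: functions with coprime periods
    are independent over a common period. *)
Lemma sum_periodic_prod (s : seq nat) (f : nat -> nat -> rat) :
  uniq s -> all prime s -> (forall p a, f p (a %% p)%N = f p a) ->
  \sum_(0 <= a < \prod_(p <- s) p) \prod_(p <- s) f p a =
  \prod_(p <- s) \sum_(0 <= a < p) f p a.
Proof.
move=> us ps per; elim: s us ps => [|p s IH] /=.
  by rewrite !big_nil big_nat1 big_nil.
move=> /andP[ps us] /andP[pp aps]; rewrite !big_cons -IH //.
set m := \prod_(q <- s) q; set u := fun a => \prod_(q <- s) f q a.
have cpm : coprime p m.
  rewrite prime_coprime // Euclid_dvd_prod // big_has; apply/hasPn => q qs.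
  by rewrite dvdn_prime2 ?(allP aps q qs) //; apply: contraNneq ps => ->.
have um i b : u (i * m + b)%N = u b.
  rewrite /u !big_seq; apply: eq_bigr => q qs.
  have qm : (q %| m)%N by rewrite /m (big_rem q qs) dvdn_mulr.
  by rewrite -per -modnDml (eqP (dvdn_mull i qm)) add0n per.
rewrite big_nat_mul /=.
have e i : \sum_(i * m <= j < i.+1 * m) \prod_(q <- p :: s) f q j =
    \sum_(0 <= b < m) f p (i * m + b)%N * u b.
  rewrite mulSn -{1}[(i * m)%N]add0n big_addn addnK; apply: eq_bigr => b _.
  by rewrite big_cons addnC -/(u _) um.
rewrite (eq_bigr _ (fun i _ => e i)) exchange_big_nat /= mulr_sumr.
by apply: eq_bigr => b _; rewrite -mulr_suml sum_shift_mod // prime_gt0.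
Qed.

(** Up to an incomplete period, the average over [0 <= a < N] is the average
    over one period. *)
Lemma periodic_sum_le (u : nat -> rat) m N M : (0 < m)%N ->
  (forall i b, u (i * m + b)%N = u b) -> (forall a, `|u a| <= M) ->
  \sum_(0 <= a < N) u a <= N%:R * ((\sum_(0 <= a < m) u a) / m%:R) + 2 * m%:R * M.
Proof.
move=> m0 per bd; set S := \sum_(0 <= a < m) u a.
have bdS r : `|\sum_(0 <= a < r) u a| <= r%:R * M.
  apply: le_trans (ler_norm_sum _ _ _) _.
  apply: le_trans (ler_sum _ (fun i _ => bd i)) _.
  by rewrite sumr_const_nat subn0 mulr_natl.
have m0' : (0 : rat) < m%:R by rewrite ltr0n.
have M0 : 0 <= M by apply: le_trans (bd 0%N).
rewrite {1}(divn_eq N m) (@big_cat_nat _ _ _ (N %/ m * m)%N) //=; last exact: leq_addr.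
rewrite big_nat_mul.
have -> : \sum_(0 <= i < N %/ m) \sum_(i * m <= j < i.+1 * m) u j = (N %/ m)%:R * S.
  rewrite (eq_bigr (fun=> S)) => [|i _].
    by rewrite sumr_const_nat subn0 mulr_natl.
  rewrite mulSn -{1}[(i * m)%N]add0n big_addn addnK; apply: eq_bigr => b _.
  by rewrite addnC per.
have -> : \sum_(N %/ m * m <= i < N %/ m * m + N %% m) u i = \sum_(0 <= i < N %% m) u i.
  rewrite -{1}[(N %/ m * m)%N]add0n big_addn addKn; apply: eq_bigr => b _.
  by rewrite addnC per.
set r := (N %% m)%N; set q := (N %/ m)%N.
have rm : r%:R <= m%:R :> rat by rewrite ler_nat ltnW // ltn_pmod.
have eN : N%:R = q%:R * m%:R + r%:R :> rat by rewrite -natrM -natrD -divn_eq.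
have -> : N%:R * (S / m%:R) = q%:R * S + r%:R * (S / m%:R).
  by rewrite eN; field; rewrite lt0r_neq0.
have hS : `|S / m%:R| <= M.
  by rewrite normrM normfV (gtr0_norm m0') ler_pdivrMr // mulrC; apply: bdS.
have h1 := le_trans (ler_norm _) (bdS r).
have h2 : - M <= S / m%:R by move: hS; rewrite ler_norml => /andP[].
have r0 := ler0n rat r.
nra.
Qed.

(** * Selberg upper bound sieve *)

(** Near orthogonality of the products of weights.  Over a full period the sum
    factors by [sum_periodic_prod]; a prime in exactly one of [A] and [B]
    contributes the mean 0 of its weight, and for [A = B] each prime contributes
    the mean square [g p].  The period and the sup norm are both at most
    [z ^ 2], whence the error [2 * z ^ 4]. *)
Lemma sum_support_prod_le (s : seq nat) (g : nat -> rat) (wt : nat -> nat -> rat) z N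
    (A B : seq nat) :
  uniq s -> all prime s ->
  (forall p a, wt p (a %% p)%N = wt p a) ->
  (forall p, p \in s -> [/\ \sum_(0 <= a < p) wt p a = 0,
     \sum_(0 <= a < p) wt p a ^+ 2 = p%:R * g p & forall a, `|wt p a| <= p%:R]) ->
  A \in sieve_supports s z -> B \in sieve_supports s z ->
  \sum_(0 <= a < N) (\prod_(p <- A) wt p a) * (\prod_(p <- B) wt p a) <=
  N%:R * (if A == B then \prod_(p <- A) g p else 0) + 2 * (z ^ 4)%:R.
Proof.
move=> us ps per hal hA hB.
have sA := mem_subseq (sieve_supports_sub hA).
have sB := mem_subseq (sieve_supports_sub hB).
have uA := subseq_uniq (sieve_supports_sub hA) us.
have uB := subseq_uniq (sieve_supports_sub hB) us.
(* C is the union of the two supports, without repetition *)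
pose C := A ++ [seq p <- B | p \notin A].
pose f p a := (if p \in A then wt p a else 1) * (if p \in B then wt p a else 1).
have uC : uniq C.
  rewrite cat_uniq uA filter_uniq // andbT.
  by apply/hasPn => p; rewrite mem_filter => /andP[].
have mC p : (p \in C) = (p \in A) || (p \in B).
  by rewrite mem_cat mem_filter; case: (p \in A).
have sC : {subset C <= s} by move=> p; rewrite mC => /orP[/sA|/sB].
have pC : all prime C by apply/allP => p /sC; apply: (allP ps).
have fprod a : (\prod_(p <- A) wt p a) * (\prod_(p <- B) wt p a) = \prod_(p <- C) f p a.
  rewrite big_split /= [X in _ = X * _]big_cat [X in _ = _ * X]big_cat /= !big_filter.
  congr (_ * _).
    rewrite [X in _ * X]big1 ?mulr1; last by move=> p /negPf ->.
    by rewrite big_seq [RHS]big_seq; apply: eq_bigr => p ->.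
  rewrite (bigID (fun p => p \in A)) /=; congr (_ * _); last first.
    rewrite big_seq_cond [RHS]big_seq_cond; apply: eq_bigr => p /andP[-> _] //.
  rewrite -big_mkcond -big_filter -[RHS]big_filter; apply: perm_big; apply: uniq_perm.
  - by rewrite filter_uniq.
  - by rewrite filter_uniq.
  by move=> p; rewrite !mem_filter andbC.
rewrite (eq_bigr _ (fun a _ => fprod a)).
pose m := \prod_(p <- C) p.
have m0 : (0 < m)%N by rewrite /m big_seq prodn_cond_gt0 // => p /(allP pC) /prime_gt0.
have mz : (m <= z ^ 2)%N.
  rewrite /m big_cat /= expnS expn1; apply: leq_mul; first exact: sieve_supports_prod hA.
  apply: leq_trans (sieve_supports_prod ps hB).
  rewrite big_filter big_mkcond [leqLHS]big_seq [leqRHS]big_seq.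
  apply: leq_prod => p /sB /(allP ps) /prime_gt0.
  by case: ifP.
have perf p a : f p (a %% p)%N = f p a by rewrite /f !per.
have peru i b : \prod_(p <- C) f p (i * m + b)%N = \prod_(p <- C) f p b.
  rewrite big_seq [RHS]big_seq; apply: eq_bigr => q qC.
  have qm : (q %| m)%N by rewrite /m (big_rem q qC) dvdn_mulr.
  by rewrite -perf -modnDml (eqP (dvdn_mull i qm)) add0n perf.
have bdA X a : X \in sieve_supports s z -> `|\prod_(p <- X) wt p a| <= z%:R.
  move=> hX; rewrite normr_prod.
  apply: le_trans (_ : (\prod_(p <- X) p)%:R <= _); last first.
    by rewrite ler_nat (sieve_supports_prod ps hX).
  rewrite natr_prod big_seq [leRHS]big_seq; apply: ler_prod => p pX; rewrite normr_ge0 /=.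
  by case: (hal p (mem_subseq (sieve_supports_sub hX) pX)).
have bd a : `|\prod_(p <- C) f p a| <= (z ^ 2)%:R.
  by rewrite -fprod normrM expnS expn1 natrM ler_pM // bdA.
apply: le_trans (periodic_sum_le N m0 peru bd) _.
apply: lerD; last first.
  rewrite -!mulrA ler_wpM2l // -natrM ler_nat -[4%N]/(2 + 2)%N expnD leq_mul2r mz orbT //.
apply: ler_wpM2l => //.
rewrite {1}/m sum_periodic_prod //.
case: eqP => [eAB|nAB].
  have eC : C = A.
    by rewrite /C -eAB (eq_in_filter (a2 := pred0)) ?filter_pred0 ?cats0 // => p ->.
  rewrite ler_pdivrMr ?ltr0n // /m eC natr_prod -big_split /=.
  rewrite le_eqVlt; apply/orP; left; apply/eqP.
  rewrite big_seq [RHS]big_seq; apply: eq_bigr => p pA.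
  have [_ h2 _] := hal p (sA _ pA).
  rewrite mulrC -h2; apply: eq_bigr => a _.
  by rewrite /f -eAB pA expr2.
have [p pC' np] : exists2 p, p \in C & (p \in A) != (p \in B).
  apply/hasP; apply/negPn/negP => /hasPn h; apply: nAB.
  rewrite (subseq_uniqP us (sieve_supports_sub hA)).
  rewrite (subseq_uniqP us (sieve_supports_sub hB)).
  apply: eq_filter => p /=; have := h p; rewrite mC negbK.
  by case: (p \in A); case: (p \in B) => //= /(_ isT).
have [h1 _ _] := hal p (sC _ pC').
rewrite (big_rem p pC') /= (eq_bigr (fun a => wt p a)) ?h1 ?mul0r // => a _.
by move: np; rewrite /f; case: (p \in A); case: (p \in B) => //; rewrite ?mul1r ?mulr1.
Qed.

(** Selberg's sieve as a dual of the large sieve: [wt p] has mean 0 and mean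
    square [g p] modulo [p], and equals [g p] on the set [P] of unsieved
    integers.  Hence the sum [F] of the products of weights over all supports
    equals [G = sieve_sum g s z] on [P], so that the count times [G ^ 2] is at
    most the sum of [F ^ 2], whose diagonal part is [N * G].  The error is crude,
    [z ^ 2] pairs of supports with [2 * z ^ 4] each, and suffices as [z] may be
    any small power of [N]. *)
Lemma selberg_sieve (s : seq nat) (g : nat -> rat) (wt : nat -> nat -> rat) z N
    (P : pred nat) :
  uniq s -> all prime s ->
  (forall p a, wt p (a %% p)%N = wt p a) ->
  (forall p, p \in s -> [/\ \sum_(0 <= a < p) wt p a = 0,
     \sum_(0 <= a < p) wt p a ^+ 2 = p%:R * g p & forall a, `|wt p a| <= p%:R]) ->
  (forall p a, p \in s -> P a -> wt p a = g p) ->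
  (count P (iota 0 N))%:R * sieve_sum g s z ^+ 2 <= N%:R * sieve_sum g s z + 2 * (z ^ 6)%:R.
Proof.
move=> us ps per hal hP.
set D := sieve_supports s z; set G := sieve_sum g s z.
pose F a := sieve_sum (fun p => wt p a) s z.
have FP a : P a -> F a = G.
  move=> Pa; rewrite /F /G !sieve_sumE big_seq [RHS]big_seq; apply: eq_bigr => A hA.
  rewrite big_seq [RHS]big_seq; apply: eq_bigr => p pA; apply: hP => //.
  exact: mem_subseq (sieve_supports_sub hA) _ pA.
apply: le_trans (_ : \sum_(0 <= a < N) F a ^+ 2 <= _).
  rewrite (bigID P) /= -[leLHS]addr0.
  apply: lerD; last by apply: sumr_ge0 => a _; apply: sqr_ge0.
  rewrite (eq_bigr (fun=> G ^+ 2)) => [|a /FP -> //].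
  rewrite -big_filter big_const_seq count_predT iter_addr_0 size_filter.
  by rewrite mulr_natl /index_iota subn0.
have e a : F a ^+ 2 =
    \sum_(A <- D) \sum_(B <- D) (\prod_(p <- A) wt p a) * (\prod_(p <- B) wt p a).
  rewrite /F sieve_sumE expr2 mulr_suml; apply: eq_bigr => A _; exact: mulr_sumr.
rewrite (eq_bigr _ (fun a _ => e a)) exchange_big /=.
rewrite (eq_bigr _ (fun A _ => exchange_big _ _ _ _ _ _)) /=.
have uD : uniq D by apply: uniq_sieve_supports.
pose diag A B := N%:R * (if A == B then \prod_(p <- A) g p else 0).
apply: le_trans (_ : \sum_(A <- D) \sum_(B <- D) (diag A B + 2 * (z ^ 4)%:R) <= _).
  rewrite big_seq [leRHS]big_seq; apply: ler_sum => A hA.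
  rewrite big_seq [leRHS]big_seq; apply: ler_sum => B hB.
  exact: (sum_support_prod_le N us ps).
rewrite (eq_bigr (fun A => \sum_(B <- D) diag A B + \sum_(B <- D) 2 * (z ^ 4)%:R));
  last by move=> A _; rewrite big_split.
rewrite big_split; apply: lerD.
  rewrite le_eqVlt; apply/orP; left; apply/eqP; rewrite /G sieve_sumE mulr_sumr.
  rewrite big_seq [RHS]big_seq; apply: eq_bigr => A hA.
  rewrite /diag -mulr_sumr (bigD1_seq A) //= eqxx [X in _ + X]big1 ?addr0 // => B.
  by rewrite eq_sym => /negPf ->.
rewrite !big_const_seq !count_predT !iter_addr_0 -mulrnA -[leLHS]mulr_natr -!mulrA.
rewrite ler_wpM2l //.
rewrite -!natrM ler_nat -[6%N]/(4 + 2)%N expnD leq_mul2l -[(z ^ 2)%N]mulnn leq_mul ?orbT //;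
  exact: size_sieve_supports.
Qed.

(** * Pairs of primes at a fixed distance *)

(** For [p] not dividing [h], the excluded residues are [0] and [-h]; the value
    [2 / (p - 2)] on the [p - 2] others gives the weight mean 0. *)
Definition twin_weight (h p a : nat) : rat :=
  if (p %| a * (a + h))%N then -1 else 2 / (p%:R - 2).

Lemma twin_weight_mod h p a : twin_weight h p (a %% p)%N = twin_weight h p a.
Proof.
rewrite /twin_weight; congr (if _ then _ else _).
by rewrite /dvdn -modnMmr modnDml modnMmr modnMml.
Qed.

Lemma count_twin_residues h p : prime p -> ~~ (p %| h)%N ->
  \sum_(0 <= a < p) (p %| a * (a + h))%:R = 2 :> rat.
Proof.
move=> pp ph; have p0 := prime_gt0 pp.
have r0 : (0 < h %% p)%N by rewrite lt0n.
have rp : (h %% p < p)%N by rewrite ltn_pmod.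
rewrite (eq_big_nat _ _ (F2 := fun a => (a == 0)%:R + (a == p - h %% p)%N%:R)); last first.
  move=> a /andP[_ ap]; rewrite Euclid_dvdM // -natrD; congr (_%:R).
  have -> : (p %| a)%N = (a == 0)%N.
    by rewrite /dvdn modn_small.
  have -> : (p %| a + h)%N = (a == p - h %% p)%N.
    rewrite /dvdn -modnDmr; apply/eqP/eqP => [|->]; last by rewrite subnK ?modnn // ltnW.
    case: (ltnP (a + h %% p) p) => [l|l]; first by rewrite modn_small //; lia.
    rewrite -(subnK l) modnDr modn_small; lia.
  by case: eqP => [->|_] //; case: eqP => //; lia.
rewrite big_split /= (bigD1_seq 0%N) ?mem_index_iota ?iota_uniq //= big1 ?addr0;
  last by move=> i /negPf ->.
rewrite (bigD1_seq (p - h %% p)%N) ?mem_index_iota ?iota_uniq //=; last by lia.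
by rewrite eqxx big1 ?addr0 // => i /negPf ->.
Qed.

Lemma twin_weight_moments h p : prime p -> (2 < p)%N -> ~~ (p %| h)%N ->
  [/\ \sum_(0 <= a < p) twin_weight h p a = 0,
     \sum_(0 <= a < p) twin_weight h p a ^+ 2 = p%:R * (2 / (p%:R - 2)) &
     forall a, `|twin_weight h p a| <= p%:R].
Proof.
move=> pp p2 ph; have c := count_twin_residues pp ph.
have p3 : 3 <= p%:R :> rat by rewrite (ler_nat _ 3).
have nz : p%:R - 2 != 0 :> rat by rewrite lt0r_neq0 //; lra.
set g : rat := 2 / (p%:R - 2).
have wE a : twin_weight h p a = g - (1 + g) * (p %| a * (a + h))%:R.
  by rewrite /twin_weight; case: (p %| _)%N => /=; rewrite ?mulr1 ?mulr0 ?subr0 //; ring.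
have wE2 a : twin_weight h p a ^+ 2 = g ^+ 2 + (1 - g ^+ 2) * (p %| a * (a + h))%:R.
  by rewrite /twin_weight; case: (p %| _)%N => /=; rewrite ?mulr1 ?mulr0 ?addr0 //; ring.
split.
- rewrite (eq_bigr _ (fun a _ => wE a)) sumrB sumr_const_nat subn0 -mulr_sumr.
  rewrite c -mulr_natr /g.
  by field.
- rewrite (eq_bigr _ (fun a _ => wE2 a)) big_split /= sumr_const_nat subn0 -mulr_sumr.
  rewrite c -mulr_natr /g.
  by field.
move=> a; rewrite /twin_weight; case: ifP => _; first by rewrite normrN1; lra.
rewrite ger0_norm; last by rewrite divr_ge0 //; lra.
by rewrite ler_pdivrMr; nra.
Qed.

Lemma smooth_sum_sub c s1 s2 z : (forall m, 0 <= c m) -> {subset s1 <= s2} ->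
  smooth_sum c s1 z <= smooth_sum c s2 z.
Proof.
move=> c0 sub; rewrite /smooth_sum big_mkcond [leRHS]big_mkcond; apply: ler_sum => m _.
case: ifP => [/allP h|_]; last by case: ifP.
by rewrite (_ : smooth s2 m) //; apply/allP => q /h /sub.
Qed.

(** With [g p = 2 / (p - 2)], the condition of [smooth_sum_le_sieve_sum] holds
    with [k = 2] and equality; the matching arithmetic function is
    [size (divisors m) / m], so that the sieve has dimension 2: its
    denominator is of the order of the square of a logarithm. *)
Lemma sieve_sum_twin_lb T y z : (1 < T)%N -> (y * y <= z)%N ->
  smooth_sum recip (primes_in T y) y ^+ 2 <=
  sieve_sum (fun p => 2 / (p%:R - 2)) (primes_in T z) z.
Proof.
move=> T1 yz.
have yz' : (y <= z)%N by case: y yz => // y yz; nia.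
apply: le_trans (_ : smooth_sum tau_recip (primes_in T z) (y * y) <= _).
  apply: le_trans (recip_sum_sq _ _).
  rewrite ler_pXn2r ?nnegrE ?smooth_sum_ge0 //; try exact: recip_ge0.
  apply: smooth_sum_sub; first exact: recip_ge0.
  by move=> p; rewrite !mem_primes_in => /and3P[-> -> /leq_trans ->].
apply: le_trans (smooth_sum_mono _ tau_recip_ge0 yz) _.
apply: (@smooth_sum_le_sieve_sum _ _ _ 2) => //; first exact: tau_recip_ge0.
move=> p; rewrite mem_primes_in => /and3P[pp Tp _].
have p3 : 3 <= p%:R :> rat by rewrite (ler_nat _ 3); lia.
split.
- exact: prime_gt1.
- by rewrite divr_ge0 //; lra.
- rewrite le_eqVlt; apply/orP; left; apply/eqP; field.
  by apply/andP; split; apply: lt0r_neq0; lra.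
by move=> m m0; apply: tau_recip_mul.
Qed.

Definition twin_count (h N : nat) : nat :=
  count (fun p => prime p && prime (p + h)) (iota 0 N).

(** Sieving by the primes between [T] and [z], where [T >= h] ensures that none
    of them divides [h].  The primes up to [z] may themselves be sieved out and
    are counted trivially. *)
Lemma twin_sieve h T y z N : (0 < h <= T)%N -> (1 < T)%N -> (y * y <= z)%N ->
  1 <= smooth_sum recip (primes_in T y) y ->
  (twin_count h N)%:R <=
    N%:R / smooth_sum recip (primes_in T y) y ^+ 2 + (2 * z ^ 6 + z + 1)%:R.
Proof.
move=> /andP[h0 hT] T1 yz; set l := smooth_sum _ _ _ => l1.
pose s := primes_in T z; pose g p : rat := 2 / (p%:R - 2).
have ps : all prime s by apply/allP => p; rewrite mem_primes_in => /andP[].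
pose P a := all (fun p => ~~ (p %| a * (a + h))%N) s.
have c1 : (twin_count h N <= count P (iota 0 N) + z.+1)%N.
  rewrite /twin_count -[X in (_ + X)%N](size_iota 0) -!size_filter -size_cat.
  rewrite uniq_leq_size ?filter_uniq ?iota_uniq // => a.
  rewrite mem_cat !mem_filter !mem_iota /= add0n => /andP[/andP[pa pah] ->].
  rewrite andbT add0n ltnS; case: (leqP a z) => [_|za]; first by rewrite orbT.
  rewrite orbF; apply/allP => p; rewrite mem_primes_in => /and3P[pp _ pz].
  by rewrite Euclid_dvdM // !dvdn_prime2 // negb_or; apply/andP; split; lia.
have := selberg_sieve (g := g) (wt := twin_weight h) z N (P := P)
  (uniq_primes_in T z) ps (twin_weight_mod h).
have hs p : p \in s -> [/\ prime p, (2 < p)%N & ~~ (p %| h)%N].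
  rewrite mem_primes_in => /and3P[pp Tp _]; split => //; first by lia.
  by apply/negP => /(dvdn_leq h0); lia.
move=> /(_ (fun p ps' => let: And3 a b c := hs p ps' in twin_weight_moments a b c)).
have hP p a : p \in s -> P a -> twin_weight h p a = g p.
  by move=> ps' /allP /(_ p ps') /negPf; rewrite /twin_weight => ->.
move=> /(_ hP); rewrite -/s.
have := sieve_sum_twin_lb T1 yz; rewrite -/s -/g -/l; set G := sieve_sum _ _ _.
set S := count P _ => lG sel.
have l2 : 1 <= l ^+ 2 by rewrite expr2; nra.
have G1 : 1 <= G by apply: le_trans lG.
have hS : S%:R <= N%:R / l ^+ 2 + 2 * (z ^ 6)%:R :> rat.
  have e1 : S%:R <= N%:R / G + 2 * (z ^ 6)%:R / G ^+ 2 :> rat.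
    rewrite (_ : _ + _ = (N%:R * G + 2 * (z ^ 6)%:R) / G ^+ 2);
      last by field; apply: lt0r_neq0; lra.
    by rewrite ler_pdivlMr // exprn_gt0 //; lra.
  apply: le_trans e1 _; apply: lerD.
    by rewrite ler_wpM2l // lef_pV2 // posrE; lra.
  have G2 : 1 <= G ^+ 2 by rewrite expr2; nra.
  have z0 : 0 <= (z ^ 6)%:R :> rat by [].
  by rewrite ler_pdivrMr ?ler_peMr //; lra.
have : (twin_count h N)%:R <= S%:R + z.+1%:R :> rat.
  by rewrite -natrD ler_nat.
rewrite !natrD natrM -natr1; lra.
Qed.

Definition close_primes (n N : nat) :=
  [seq p <- iota 0 N | prime p && has (fun h => prime (p + h)) (iota 1 n.-1)].

Lemma size_close_primes n N :
  (size (close_primes n N) <=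
     \sum_(1 <= h < n) twin_count h N)%N.
Proof.
rewrite /twin_count size_filter /index_iota subn1; elim: (iota 1 n.-1) => [|h r IH].
  by rewrite big_nil; elim: (iota 0 N) => //= a l; rewrite andbF.
rewrite big_cons; apply: leq_trans (leq_add (leqnn _) IH).
rewrite -count_predUI; apply: leq_trans (leq_addr _ _).
by apply: sub_count => p /= /andP[-> /orP[->|->]] //; rewrite orbT.
Qed.

(** The choice [T = n + 2] serves all [0 < h < n] at once, and [y = 2 ^ v] makes
    the harmonic piece at least a constant times [v]; [v ^ 2] stands for
    log^2 N. *)
Lemma close_primes_ub n : exists C v0 : nat, forall v, (v0 <= v)%N ->
  (v ^ 2 * size (close_primes n (2 ^ (24 * v)).+1) <= C * 2 ^ (24 * v))%N.
Proof.
pose T := n.+2; pose D := T`!; pose c := (4 * (D + 1))%N.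
exists (n * (2 * c ^ 2 + 4))%N, c => v cv.
set N := (2 ^ (24 * v))%N.
have hl : v%:R / c%:R <= smooth_sum recip (primes_in T (2 ^ v)) (2 ^ v).
  have : (T`! * 2 ^ (v - D) < 2 ^ v)%N.
    (* D < 2 ^ D leaves room for the factor T`! of rough_sum_lb *)
    have -> : (2 ^ v = 2 ^ D * 2 ^ (v - D))%N by rewrite -expnD; congr (_ ^ _)%N; lia.
    by rewrite ltn_pmul2r ?expn_gt0 // ltn_expl.
  move/rough_sum_lb; apply: le_trans.
  have D0 : 0 < D%:R :> rat by rewrite ltr0n fact_gt0.
  have e : v%:R / 2 <= (v - D)%:R :> rat.
    by rewrite ler_pdivrMr // -natrM ler_nat; lia.
  rewrite /c -/D natrM natrD.
  apply: le_trans (_ : v%:R / 2 / (2 * (D%:R + 1)) <= _).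
    rewrite le_eqVlt; apply/orP; left; apply/eqP; field; apply: lt0r_neq0; lra.
  by apply: ler_wpM2r => //; rewrite invr_ge0; lra.
set l := smooth_sum _ _ _ in hl.
have c0 : 0 < c%:R :> rat by rewrite ltr0n; lia.
have l1 : 1 <= l by apply: le_trans hl; rewrite ler_pdivlMr // mul1r ler_nat.
have v0 : (0 < v)%N by lia.
have pw : (v ^ 2 <= 2 ^ (12 * v))%N.
  rewrite (_ : 12 * v = 6 * v * 2)%N; last by lia.
  rewrite expnM leq_exp2r //; apply: leq_trans (ltnW (ltn_expl v (isT : 1 < 2)%N)) _.
  by rewrite leq_exp2l //; lia.
have NN : N = (2 ^ (12 * v) * 2 ^ (12 * v))%N by rewrite -expnD /N; congr (_ ^ _)%N; lia.
set M := (2 ^ (12 * v))%N in pw NN.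
have one h : (0 < h < n)%N ->
  (v ^ 2 * twin_count h N.+1 <= (2 * c ^ 2 + 4) * N)%N.
  move=> hn.
  have := @twin_sieve h T (2 ^ v) (2 ^ (2 * v)) N.+1 ltac:(lia) ltac:(lia).
  rewrite -expnD addnn mul2n leqnn => /(_ isT l1); rewrite -/l.
  set cnt := twin_count _ _ => h1.
  have z6 : ((2 ^ v.*2) ^ 6 = M)%N by rewrite -expnM /M; congr (_ ^ _)%N; lia.
  have zM : (2 ^ v.*2 <= M)%N by rewrite /M leq_exp2l //; lia.
  have M1 : (0 < M)%N by rewrite /M expn_gt0.
  have h2 : cnt%:R <= N.+1%:R / l ^+ 2 + (4 * M)%:R :> rat.
    by apply: le_trans h1 _; rewrite lerD2l ler_nat z6; lia.
  have h3 : v%:R ^+ 2 * (N.+1%:R / l ^+ 2) <= N.+1%:R * c%:R ^+ 2 :> rat.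
    rewrite mulrCA ler_wpM2l // ler_pdivrMr ?exprn_gt0 //; last by lra.
    rewrite -exprMn ler_pXn2r ?nnegrE ?mulr_ge0 //; last by lra.
    by move: hl; rewrite ler_pdivrMr // mulrC.
  have h4 : (v ^ 2 * cnt)%:R <= (N.+1 * c ^ 2 + v ^ 2 * (4 * M))%:R :> rat.
    rewrite natrM natrD (natrM _ N.+1) (natrM _ (v ^ 2)) !natrX.
    apply: le_trans (ler_wpM2l (sqr_ge0 _) h2) _.
    by rewrite mulrDr lerD2r.
  rewrite ler_nat in h4; apply: leq_trans h4 _.
  have : (N.+1 <= 2 * N)%N by rewrite /N; have := expn_gt0 2 (24 * v); lia.
  have : (v ^ 2 * M <= N)%N by rewrite NN leq_mul2r pw orbT.
  by nia.
apply: leq_trans (leq_mul (leqnn _) (size_close_primes _ _)) _.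
rewrite big_distrr /= big_nat.
apply: leq_trans (leq_sum _ one) _.
rewrite -big_nat sum_nat_const_nat -mulnA leq_mul2r; apply/orP; right; lia.
Qed.

(** * Abundance of products of two primes *)

Lemma prime_pi_le_primes_in T y : (prime_pi y <= size (primes_in T y) + T.+1)%N.
Proof.
rewrite prime_piE -size_filter -(size_iota 0 T.+1) -size_cat.
rewrite uniq_leq_size ?filter_uniq ?iota_uniq // => p.
rewrite mem_cat mem_primes_in mem_filter !mem_iota => /andP[-> /=].
by rewrite !add0n !ltnS => ->; rewrite andbT; case: leqP.
Qed.

Lemma P2_number_mul p q : prime p -> prime q -> P2_number (p * q).
Proof.
move=> pp pq; exists [:: p; q]; split => //=; first by rewrite pp pq.
by rewrite !big_cons big_nil muln1.
Qed.

(** The products [p * q] with [p <= T < q] are distinct, the smaller factor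
    being recognizable.  For fixed [T], Chebyshev's bound at [x / p] gives about
    [x / (2 * L * p)] of them for each [p], and [T] is chosen so that the sum
    of the [1 / p] is at least [K / 2]. *)
Lemma P2_numbers_lb K : exists c : nat, forall L x, (0 < L)%N -> (x <= 2 ^ L)%N ->
  exists S : seq nat, [/\ uniq S, forall m, m \in S -> P2_number m /\ (0 < m <= x)%N &
    (K * x <= 4 * L * (size S + c))%N].
Proof.
have [T hT] := prime_recip_diverges K.
exists (size (primes_in 0 T) * (T + 3))%N => L x L0 xL.
exists [seq (p * q)%N | p <- primes_in 0 T, q <- primes_in T (x %/ p)]; split.
- apply: allpairs_uniq_dep; first exact: uniq_primes_in.
    by move=> p _; apply: uniq_primes_in.
  move=> u1 u2 /allpairsPdep[p [q [hp hq ->]]] /allpairsPdep[p' [q' [hp' hq' ->]]] /= e.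
  move: hp hq hp' hq'; rewrite !mem_primes_in.
  move=> /and3P[pp _ pT] /and3P[pq Tq _] /and3P[pp' _ pT'] /and3P[pq' Tq' _].
  have : (p %| p' * q')%N by rewrite -e dvdn_mulr.
  rewrite Euclid_dvdM // !dvdn_prime2 // => /orP[/eqP ep|/eqP ep]; last by lia.
  rewrite -ep in e *; congr (existT _ _ _).
  by apply/eqP; rewrite -(eqn_pmul2l (prime_gt0 pp)) e.
- move=> m /allpairsPdep[p [q [hp hq ->]]].
  move: hp hq; rewrite !mem_primes_in => /and3P[pp _ pT] /and3P[pq Tq qx].
  split; first exact: P2_number_mul.
  by rewrite muln_gt0 !prime_gt0 //= mulnC -leq_divRL ?prime_gt0.
rewrite size_allpairs_dep.
have h : (x%:R * \sum_(p <- primes_in 0 T) recip p : rat) <=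
   (2 * L * (\sum_(p <- primes_in 0 T) (size (primes_in T (x %/ p)) + (T + 3))))%:R.
  rewrite natrM natr_sum !mulr_sumr big_seq [leRHS]big_seq; apply: ler_sum => p.
  rewrite mem_primes_in => /and3P[pp _ _].
  rewrite /recip ler_pdivrMr ?ltr0n ?prime_gt0 // -!natrM ler_nat.
  have p0 := prime_gt0 pp.
  have := ltn_ceil x p0; have := chebyshev L0 (leq_trans (leq_div x p) xL).
  have := prime_pi_le_primes_in T (x %/ p); nia.
rewrite big_split /= [X in (_ * (_ + X))%N]big_const_seq count_predT iter_addn_0 in h.
rewrite sumnE big_map; set Z := (\sum_(p <- _) size _)%N in h *.
set W := \sum_(_ <- _) _ in hT h; set k := size _ in h *.
have : K%:R * x%:R <= (4 * L * (Z + k * (T + 3)))%:R :> rat.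
  have x0 := ler0n rat x; rewrite [(4 * L)%N](_ : _ = 2 * (2 * L))%N; last by lia.
  by rewrite -mulnA natrM [(k * _)%N]mulnC; nra.
by rewrite -natrM ler_nat.
Qed.

Local Close Scope ring_scope.

(** * Values missed by the prime counting function on multiples *)

Lemma prime_piS x : prime_pi x.+1 = prime_pi x + prime x.+1.
Proof. by rewrite !prime_piE -addn1 iotaD count_cat /= addn0 add0n. Qed.

(** [prime_pi] grows by steps of at most 1, and only at primes. *)
Lemma prime_pi_hit m X : 0 < m <= prime_pi X ->
  exists p, [/\ prime p, p <= X & prime_pi p = m].
Proof.
elim: X => [|X IH] /andP[m0 mX]; first by move: mX; rewrite prime_piE /=; lia.
have [h|h] := leqP m (prime_pi X).
  have [|p [pp pX e]] := IH; first by rewrite m0.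
  by exists p; split => //; apply: leqW.
move: mX; rewrite prime_piS; case: (boolP (prime X.+1)) => [pX mX|_]; last by lia.
by exists X.+1; split => //; rewrite prime_piS pX; lia.
Qed.

(** The first multiple of [n] from [p] on is at most [p + n - 1]; if no prime
    followed [p] up to there, [prime_pi] would take the same value at both. *)
Lemma next_prime_close n p : 0 < n -> prime p ->
  (forall k, 0 < k -> prime_pi (k * n) <> prime_pi p) ->
  has (fun h => prime (p + h)) (iota 1 n.-1).
Proof.
move=> n0 pp hk; apply/negPn/negP => /hasPn no.
pose k := (p + n.-1) %/ n.
have kp : p <= k * n by have := ltn_ceil (p + n.-1) n0; rewrite -/k; lia.
have kn : k * n <= p + n.-1 by apply: leq_divM.
have k0 : 0 < k by rewrite divn_gt0 //; have := prime_gt0 pp; lia.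
apply: (hk k k0); rewrite -(subnKC kp).
have : k * n - p <= n.-1 by lia.
elim: (k * n - p) => [|h IH] hn; first by rewrite addn0.
rewrite addnS prime_piS IH ?(ltnW hn) // -addnS (negPf (no _ _)) ?addn0 //.
by rewrite mem_iota; lia.
Qed.

Lemma missed_in_close_primes n m X : 0 < n -> 0 < m <= prime_pi X ->
  ~ pi_multiples n m -> m \in map prime_pi (close_primes n X.+1).
Proof.
move=> n0 mX nm; have [p [pp pX e]] := prime_pi_hit mX.
apply/mapP; exists p => //; rewrite mem_filter mem_iota pp ltnS pX leq0n !andbT /=.
apply: next_prime_close => // k k0; rewrite e => ek; apply: nm.
by exists k.
Qed.

Local Open Scope classical_set_scope.

Theorem corollary1p2 (n : nat) (hn : 0 < n) :
  infinite_set (pi_multiples n `&` [set m | P2_number m]).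
Proof.
move=> /finite_seqP[s0 hs0].
have [C [v0 gaps]] := close_primes_ub n.
(* 2304 = 4 * 24 ^ 2 collects the factors relating 24 * v to the two bounds, so
   that K * N beats the contribution C * N of the close primes *)
pose K := 2304 * C + 1.
have [c hP2] := P2_numbers_lb K.
pose B := 2304 * (size s0 + c) + 24 * K.
(* v > B makes v ^ 2 * B smaller than v ^ 3 < N *)
pose v := maxn v0 B.+1.
have vB : B < v by rewrite leq_max leqnn orbT.
have {gaps} := gaps v (leq_maxl _ _).
set N := 2 ^ (24 * v); set g := size _ => gaps.
have L0 : 0 < 24 * v by lia.
have cheb := chebyshev_pow2 L0; rewrite -/N in cheb.
set x := prime_pi N in cheb.
have xN : x <= N.
  rewrite /x prime_piE /= -[leqRHS](size_iota 1); exact: count_size.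
have [S [uS S1 S2]] := hP2 _ _ L0 xN.
have sizeS : size S <= size s0 + g.
  rewrite /g -(size_map prime_pi (close_primes _ _)) -size_cat.
  apply: uniq_leq_size => // m mS.
  have [P2m mx] := S1 m mS; rewrite mem_cat.
  have [//|ms0] := boolP (m \in s0).
  apply: missed_in_close_primes => // pm.
  have : (pi_multiples n `&` [set m | P2_number m])%classic m by split.
  by rewrite hs0 /= (negPf ms0).
have vN : v * v ^ 2 < N.
  rewrite -expnS; apply: (@leq_ltn_trans ((2 ^ v) ^ 3)).
    by rewrite leq_exp2r //; apply: ltnW; apply: ltn_expl.
  by rewrite -expnM /N ltn_exp2l //; lia.
have h1 : K * N <= 24 * v * (K * x) + 24 * v * K by nia.
have h2 : 24 * v * (K * x) <= 24 * v * (4 * (24 * v) * (size s0 + g + c)).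
  rewrite leq_mul2l; apply/orP; right; apply: leq_trans S2 _.
  by rewrite leq_mul2l; apply/orP; right; lia.
have h3 : 24 * v * (4 * (24 * v) * (size s0 + g + c)) =
    2304 * (v ^ 2 * g) + v ^ 2 * (2304 * (size s0 + c)).
  by rewrite -[v ^ 2]mulnn; lia.
have h4 : 24 * v * K <= v ^ 2 * (24 * K).
  by rewrite mulnAC mulnC leq_mul2r -mulnn leq_pmulr ?orbT //; lia.
have h5 : K * N <= 2304 * (C * N) + v ^ 2 * B by rewrite /B; lia.
have h6 : v ^ 2 * B <= v * v ^ 2 by rewrite mulnC leq_mul2r ltnW ?orbT.
by move: h5; rewrite /K; lia.
Qed.
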